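(* Assume that the operator $P$ associated to the Markov chain $\xi_1,\xi_2,\ldots$ is normal. Then the spectral radius $\rho$ is given by $$\rho=\lim_{n\to\infty}\Bigl(\sqrt{1-k_{P^{*n}P^n}}\Bigr)^{1/n}.$$ In particular, if the Markov chain is reversible, then $$\rho=\lim_{n\to\infty}\Bigl(\sqrt{1-k_{2n}}\Bigr)^{1/n}.$$ Moreover, if the Markov chain is reversible and also positive (i.e. $P$ is a positive selfadjoint operator), then $$\rho=\lim_{n\to\infty}(1-k_n)^{1/n}.$$
   Context: Standing assumptions: $\xi_1,\xi_2,\ldots$ is a time-homogeneous, discrete-time, $\pi$-irreducible positive recurrent Markov chain on a state space $(\Omega,\mathcal{F})$ with $\mathcal{F}$ countably generated, transition kernel $p(\cdot,\cdot)$ ($n$-step kernel $p^n$) and unique invariant probability measure $\pi$. The Markov operator is $Pf(x)=\int_\Omega f(y)\,p(x,dy)$ on $L^2(\pi)$ and $P^*$ is its adjoint on $L^2(\pi)$; $P^{*n}P^n$ means $(P^* )^nP^n$. Put $L_0^2(\pi)=\{f\in L^2(\pi):\int f\,d\pi=0\}$; $P$ is regarded as an operator on $L_0^2(\pi)$, and $$\rho=\lim_{n\to\infty}\sup\{\|P^nf\|_2^{1/n}: f\in L_0^2(\pi),\|f\|_2=1\}.$$ The chain is reversible if $\pi(dx)p(x,dy)=\pi(dy)p(y,dx)$ (equivalently $P$ is selfadjoint). For $A\in\mathcal{F}$ with $0<\pi(A)<1$ (infima over $A$ are over such sets, assumed to exist), put $$k_n(A)=\frac{1}{\pi(A)\pi(A^c)}\int_A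 p^n(x,A^c)\,\pi(dx),\qquad k_n=\inf_{A}k_n(A),$$ $$k_{P^{*n}P^n}(A)=\frac{1}{\pi(A)\pi(A^c)}\int_A P^{*n}P^n1_{A^c}(x)\,\pi(dx),\qquad k_{P^{*n}P^n}=\inf_A k_{P^{*n}P^n}(A).$$ *)

(* Defs.v *)
From HB Require Import structures.
From mathcomp Require Import all_boot all_order all_algebra.
From mathcomp Require Import all_classical all_reals all_analysis.

Set Implicit Arguments.
Unset Strict Implicit.
Unset Printing Implicit Defensive.
Import Order.TTheory GRing.Theory Num.Theory.
Import numFieldNormedType.Exports.
Local Open Scope classical_set_scope.
Local Open Scope ring_scope.

Definition countably_generated (d : measure_display) (T : measurableType d) :=
  exists2 G : set (set T), countable G & @measurable d T = <<s G >>.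

Section MarkovChain.
Context (d : measure_display) (T : measurableType d) (R : realType).
Variable p : R.-pker T ~> T.

(* p^0 is the Dirac kernel, p^(n+1) (x, A) = \int p (x, dy) p^n (y, A) *)
Fixpoint nstep (n : nat) : R.-spker T ~> T :=
  if n is m.+1 then mkcomp_noparam p (nstep m)
  else kdirac (@measurable_id d T setT).

Variable pi : probability T R.

Definition invariant (mu : probability T R) :=
  forall A, measurable A -> (\int[mu]_x p x A = mu A)%E.

Definition unique_invariant := invariant pi /\
  forall mu : probability T R, invariant mu ->
    forall A, measurable A -> mu A = pi A.

Definition irreducible := forall x A, measurable A -> (0 < pi A)%E ->
  exists n : nat, (0 < n)%N /\ (0 < nstep n x A)%E.

(* The expected number of visits to A is infinite from every starting point. *)
Definition recurrent := forall x A, measurable A -> (0 < pi A)%E ->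
  (\sum_(1 <= n <oo) nstep n x A = +oo)%E.

Definition positive_recurrent := recurrent /\ unique_invariant.

(* Equality of the measures pi(dx)p(x,dy) and pi(dy)p(y,dx) on the product
   sigma-algebra. *)
Definition reversible := forall C : set (T * T), measurable C ->
  (\int[pi]_x p x (xsection C x) = \int[pi]_y p y (ysection C y))%E.

(* Elements of L^2(pi) are represented by square-integrable functions T -> R,
   and operators on L^2(pi) by maps on functions; equalities between elements
   of L^2(pi) are therefore equalities pi-almost everywhere. *)
Definition L2 : set (T -> R) := [set f | f \in Lfun pi 2%:E].

Definition L20 : set (T -> R) := [set f | L2 f /\ \int[pi]_x f x = 0].

Definition norm2 (f : T -> R) : R := fine ('N[pi]_2%:E [EFin \o f])%E.

Definition inner (f g : T -> R) : R := \int[pi]_x (f x * g x).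

Definition markov_op (f : T -> R) : T -> R := fun x => \int[p x]_y f y.

(* Qstar is determined by this only up to pi-null sets. *)
Definition is_adjoint (Q Qstar : (T -> R) -> T -> R) :=
  forall g, L2 g -> L2 (Qstar g) /\
    forall f, L2 f -> inner (Q f) g = inner f (Qstar g).

(* Q Q* = Q* Q for Q regarded as an operator on L^2_0(pi). For the Markov
   operator this is the same as Q Q* = Q* Q on L^2(pi), because it fixes the
   constants, and so does its adjoint. *)
Definition normal_with (Q Qstar : (T -> R) -> T -> R) :=
  forall f, L20 f -> Q (Qstar f) = Qstar (Q f) %[ae pi].

(* Only non-negativity of the quadratic form on L^2_0(pi): self-adjointness of
   the Markov operator is reversibility. As it fixes the constants, a
   self-adjoint Markov operator is then non-negative on the whole of L^2(pi). *)
Definition positive_op (Q : (T -> R) -> T -> R) :=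
  forall f, L20 f -> 0 <= inner (Q f) f.

Definition spectral_radius : R := limn (fun n : nat =>
  sup [set norm2 (iter n markov_op f) `^ n%:R^-1 |
       f in [set f | L20 f /\ norm2 f = 1]]).

Definition nontrivial : set (set T) :=
  [set A | measurable A /\ (0 < pi A < 1)%E].

Definition flow (h : T -> R) (A : set T) : R :=
  (fine (pi A) * fine (pi (~` A)))^-1 * \int[pi]_(x in A) h x.

Definition k_step (n : nat) : R :=
  inf [set flow (fun x => fine (nstep n x (~` A))) A | A in nontrivial].

(* k_{P*^n P^n} when Pstar is the adjoint of the Markov operator *)
Definition k_adj (Pstar : (T -> R) -> T -> R) (n : nat) : R :=
  inf [set flow (iter n Pstar (iter n markov_op (\1_(~` A)))) A
      | A in nontrivial].

End MarkovChain.

(* Main.v *)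
(* Let q n f be |P^n f|^2 when P is normal, and <P^n f, f> when P is positive
   selfadjoint.  For f in L^2_0, q n f is log-convex in n, and
   1 - k_n = sup_A q n f_A / |f_A|^2, where f_A = 1_A - pi(A).  By
   log-convexity (1 - k_n)^(1/n) increases to some s <= 1, so that
   q n f_A <= s^n |f_A|^2 for all A.  The f such that, for some C, q n f <= C s^n
   for all n form a linear space, on which log-convexity allows taking
   C = |f|^2; this makes the space closed.  It contains the f_A, so it is all of
   L^2_0.  Hence |P^n f|^2 is at most s^n |f|^2, resp. s^(2n) |f|^2, which
   bounds the spectral radius above by sqrt s, resp. s; restricting the supremum
   over f to the f_A gives the lower bound. *)

Require Import Defs.
From HB Require Import structures.
From mathcomp Require Import all_boot all_order all_algebra.
From mathcomp Require Import all_classical all_reals all_analysis.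
From mathcomp Require Import measurable_realfun giry.
From mathcomp Require Import ring lra.

Set Implicit Arguments.
Unset Strict Implicit.
Unset Printing Implicit Defensive.
Import Order.TTheory GRing.Theory Num.Theory.
Import numFieldNormedType.Exports.
Local Open Scope classical_set_scope.
Local Open Scope ring_scope.

(** * Real sequences: discriminants, log-convexity and limits of n-th roots *)

Section RealLemmas.
Context {R : realType}.
Implicit Types (u : nat -> R) (s C : R).

Lemma quadratic_ge0_discr (a b c : R) :
  (forall t, 0 <= a + 2 * t * b + t ^+ 2 * c) -> b ^+ 2 <= a * c.
Proof.
move=> h.
have c0 : 0 <= c.
  rewrite leNgt; apply/negP => c0.
  have a0 : 0 <= a by have := h 0; rewrite mulr0 mul0r expr0n/= mul0r !addr0.
  (* For negative [c] this [t] makes [t * - c] exceed [2 * |b| + a], so the quadratic is at most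
     [c - 1 < 0] there. *)
  set t := (2 * `|b| + a + 1) / - c + 1.
  have t1 : 1 <= t.
    by rewrite lerDr divr_ge0 ?oppr_ge0 ?(ltW c0)//; have := normr_ge0 b; lra.
  have tc : t * - c = 2 * `|b| + a + 1 - c.
    by rewrite /t mulrDl mul1r divfK ?oppr_eq0 ?lt_eqF.
  have := h t.
  have hb : t * b <= t * `|b| by rewrite ler_wpM2l ?ler_norm//; lra.
  have -> : t ^+ 2 * c = - (t * (t * - c)) by ring.
  rewrite tc; have := normr_ge0 b; nra.
have [c00|cn0] := eqVneq c 0.
  move: h; rewrite c00 mulr0 => h.
  have [->|b0] := eqVneq b 0; first by rewrite expr0n.
  (* With [c = 0] the expression is affine in [t], and at this [t] it equals -1. *)
  have := h (- (a + 1) / (2 * b)); rewrite mulr0 addr0.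
  have -> : 2 * (- (a + 1) / (2 * b)) * b = - (a + 1) by field.
  lra.
have cp : 0 < c by rewrite lt_neqAle eq_sym cn0.
have := h (- b / c).
have -> : a + 2 * (- b / c) * b + (- b / c) ^+ 2 * c = (a * c - b ^+ 2) / c.
  by field.
by rewrite pmulr_lge0 ?invr_gt0// subr_ge0.
Qed.

(** A ratio [u n.+1 / u n] above [s] would persist for all later indices and beat [C * s ^+ n]
    whatever [C] is; so every ratio is at most [s], and the bound starts from [u 0]. *)
Lemma logconvex_geometric_bound u s C : 0 <= s -> (forall n, 0 <= u n) ->
  (forall n, u n.+1 ^+ 2 <= u n * u n.+2) ->
  (forall n, u n <= C * s ^+ n) -> forall n, u n <= u 0%N * s ^+ n.
Proof.
move=> s0 u0 lc uC.
suff step n : u n.+1 <= s * u n.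
  elim=> [|n IH]; first by rewrite expr0 mulr1.
  by rewrite (le_trans (step n))// exprS mulrCA ler_wpM2l.
rewrite leNgt; apply/negP => sltu.
have un0 : 0 < u n.
  rewrite lt_neqAle u0 andbT eq_sym; apply/eqP => un0.
  have := lc n; rewrite un0 mul0r => h.
  by move: sltu; rewrite un0 mulr0 lt_neqAle eq_sym -sqrf_eq0 eq_le h sqr_ge0.
(* The ratios of consecutive terms are nondecreasing, so from n on u grows at
   least like r ^+ k with r > s. *)
pose r := u n.+1 / u n.
have sr : s < r by rewrite /r ltr_pdivlMr.
have r0 : 0 < r by exact: le_lt_trans sr.
have ratio k : 0 < u (n + k)%N /\ r * u (n + k)%N <= u (n + k).+1.
  elim: k => [|k [uk IH]]; first by rewrite addn0 /r divfK ?gt_eqF.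
  have uk1 : 0 < u (n + k).+1 by apply: lt_le_trans IH; rewrite mulr_gt0.
  rewrite addnS; split => //.
  rewrite -(ler_pM2l uk) (le_trans _ (lc _))// expr2 mulrA ler_wpM2r ?(ltW uk1)//.
  by rewrite mulrC.
have growth k : r ^+ k * u n <= u (n + k)%N.
  elim: k => [|k IH]; first by rewrite expr0 mul1r addn0.
  rewrite addnS (le_trans _ (ratio k).2)// exprS -mulrA.
  by rewrite ler_wpM2l // (ltW r0).
(* Growth from below and the assumed bound from above meet at index [n + k]; since [s / r < 1],
   letting [k] grow forces [u n <= 0]. *)
have decay k : u n <= (C * s ^+ n) * (s / r) ^+ k.
  rewrite expr_div_n mulrA ler_pdivlMr ?exprn_gt0// mulrC.
  by rewrite (le_trans (growth k))// -mulrA -exprD.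
have : u n <= 0.
  have cv : (C * s ^+ n) * (s / r) ^+ k @[k --> \oo] --> (0 : R).
    apply: cvg_geometric.
    by rewrite ger0_norm ?divr_ge0 ?(ltW r0)// ltr_pdivrMr// mul1r.
  have cl : limn (fun k => C * s ^+ n * (s / r) ^+ k) = 0 :> R.
    exact: cvg_lim cv.
  by rewrite -cl; apply: limr_ge; [apply/cvg_ex; exists 0|exact: nearW].
by rewrite leNgt un0.
Qed.

(** This is the monotonicity of the n-th root of [u n], written without roots. For the induction
    step, raise log-convexity to the power [n.+1], bound [u n ^+ n.+1] by the induction hypothesis,
    and cancel [u n.+1 ^+ n]. *)
Lemma logconvex_power_mean u : u 0%N = 1 -> (forall n, 0 <= u n) ->
  (forall n, u n.+1 ^+ 2 <= u n * u n.+2) ->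
  forall n, u n ^+ n.+1 <= u n.+1 ^+ n.
Proof.
move=> u01 u0 lc; elim=> [|n IH]; first by rewrite u01 expr1n expr0.
have [un0|un1] := eqVneq (u n.+1) 0.
  by rewrite un0 expr0n/= exprn_ge0.
have up : 0 < u n.+1 by rewrite lt_neqAle eq_sym un1 u0.
rewrite -(ler_pM2l (exprn_gt0 n up)) -exprD.
have -> : (n + n.+2 = 2 * n.+1)%N by rewrite !addnS mul2n doubleS addnn.
rewrite exprM (le_trans (lerXn2r _ _ _ (lc n)))// ?nnegrE ?mulr_ge0 ?sqr_ge0//.
by rewrite exprMn ler_wpM2r ?exprn_ge0.
Qed.

Lemma sqrrB_le (x y z w : R) :
  x ^+ 2 <= z -> y ^+ 2 <= w -> (x - y) ^+ 2 <= 2 * (z + w).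
Proof. by move=> xz yw; have := sqr_ge0 (x + y); nra. Qed.

Lemma ler_rootn (x y : R) n : 0 <= x -> 0 <= y -> x <= y ^+ n.+1 ->
  x `^ n.+1%:R^-1 <= y.
Proof.
move=> x0 y0 xy.
have -> : y = (y ^+ n.+1) `^ n.+1%:R^-1.
  by rewrite -powR_mulrn// -powRrM mulfV ?pnatr_eq0// powRr1.
by rewrite ge0_ler_powR ?invr_ge0// nnegrE// exprn_ge0.
Qed.

Lemma rootnK (x : R) n : 0 <= x -> (x `^ n.+1%:R^-1) ^+ n.+1 = x.
Proof.
by move=> x0; rewrite -powR_mulrn ?powR_ge0// -powRrM mulVf ?pnatr_eq0// powRr1.
Qed.

Lemma sqrt_rootn (x : R) n : 0 <= x ->
  (Num.sqrt x) `^ n%:R^-1 = Num.sqrt (x `^ n%:R^-1).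
Proof. by move=> x0; rewrite -!powR12_sqrt ?powR_ge0// powRAC. Qed.

(** The last two hypotheses say that [b n] is the supremum of the [a i n]. The roots of each [a i]
    are nondecreasing, and this passes to the supremum although [b] itself need not be known to be
    log-convex. *)
Lemma logconvex_sup_root_cvg {I : Type} (D : set I) (a : I -> nat -> R) b :
  D !=set0 ->
  (forall i, D i -> a i 0%N = 1) ->
  (forall i n, D i -> 0 <= a i n <= 1) ->
  (forall i n, D i -> a i n.+1 ^+ 2 <= a i n * a i n.+2) ->
  (forall i n, D i -> a i n <= b n) ->
  (forall n c, (forall i, D i -> a i n <= c) -> b n <= c) ->
  exists s, [/\ 0 <= s, s <= 1, b n `^ n%:R^-1 @[n --> \oo] --> s &
    forall i n, D i -> a i n <= s ^+ n].
Proof.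
move=> [i0 Di0] a1 a01 lc ab bmin.
have b0 n : 0 <= b n.
  by rewrite (le_trans _ (ab i0 n Di0))//; case/andP: (a01 i0 n Di0).
have b1 n : b n <= 1 by apply: bmin => i Di; case/andP: (a01 i n Di).
(* The index is shifted because [0%:R^-1] is 0, so that the term at 0 is not a genuine root. *)
pose v n := b n.+1 `^ n.+1%:R^-1.
have v0 n : 0 <= v n by exact: powR_ge0.
have vE n : v n ^+ n.+1 = b n.+1 by rewrite rootnK.
have v1 n : v n <= 1 by apply: ler_rootn => //; rewrite expr1n.
have vnd : nondecreasing_seq v.
  apply/nondecreasing_seqP => n; apply: ler_rootn => //.
  apply: bmin => i Di.
  have ai m : 0 <= a i m by case/andP: (a01 i m Di).
  (* After raising to the power [n.+2], the chain is [a i n.+1 ^+ n.+2 <= a i n.+2 ^+ n.+1 <= b n.+2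
     ^+ n.+1]. *)
  rewrite -(@ler_pXn2r _ n.+2) ?nnegrE ?exprn_ge0//.
  apply: le_trans (logconvex_power_mean (a1 _ Di) ai (fun m => lc i m Di) _) _.
  by rewrite exprAC lerXn2r ?nnegrE ?exprn_ge0// vE; exact: ab.
have vcv : cvgn v.
  by apply: nondecreasing_is_cvgn => //; exists 1 => _ [n _ <-].
have vs n : v n <= limn v by exact: nondecreasing_cvgn_le.
have s0 : 0 <= limn v by exact: le_trans (v0 0%N) (vs 0%N).
exists (limn v); split => //.
- by apply: limr_le => //; exact: nearW.
- by rewrite -cvg_shiftS.
- move=> i [|n] Di; first by rewrite a1// expr0.
  rewrite (le_trans (ab i _ Di))// -vE lerXn2r ?nnegrE//.
Qed.

End RealLemmas.

(** * Inner product and centering on square-integrable functions *)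

Section SquareIntegrable.
Context (d : measure_display) (T : measurableType d) (R : realType).
Variable pi : probability T R.
Implicit Types (f g h : T -> R) (c : R).
Local Notation L2 := (L2 pi).
Local Notation inner := (inner pi).

Lemma L2P f : L2 f <->
  measurable_fun setT f /\ pi.-integrable setT (EFin \o (fun x => f x ^+ 2)).
Proof.
rewrite /Defs.L2 /=; split => [f2|[mf intf]].
  split; last exact: Lfun2_integrable_sqr.
  by move: f2; rewrite inE => /andP[/[!inE]].
rewrite inE; apply/andP; split; rewrite inE//= /finite_norm unlock.
rewrite poweR_lty//; move/integrableP : intf => [_]; apply: le_lt_trans.
rewrite le_eqVlt; apply/orP; left; apply/eqP; apply: eq_integral => x _ /=.
by rewrite powR_mulrn// normrX.
Qed.

Lemma L2_measurable f : L2 f -> measurable_fun setT f.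
Proof. by move=> /L2P[]. Qed.

Lemma L2_lin f c g : L2 f -> L2 g -> L2 (fun x => f x + c * g x).
Proof.
move=> f2 g2.
have -> : (fun x => f x + c * g x) = c *: g + f.
  by apply/funext => x; rewrite addrC.
exact: (Lfun_submod_closed pi (lee1n 2)).2.
Qed.

Lemma L2_cst c : L2 (fun=> c).
Proof. exact: Lfun_cst. Qed.

Lemma L2_bounded f c : measurable_fun setT f -> (forall x, `|f x| <= c) -> L2 f.
Proof.
move=> mf fc; apply/L2P; split => //.
apply: (le_integrable measurableT _ _
  (finite_measure_integrable_cst pi (c ^+ 2) measurableT)).
  by apply/measurable_EFinP; exact: measurable_funX.
move=> x _ /=; rewrite lee_fin normrX [leRHS]ger0_norm ?sqr_ge0//.
by rewrite lerXn2r ?nnegrE// (le_trans _ (fc x)).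
Qed.

Lemma L2_indic (A : set T) : measurable A -> L2 (\1_A).
Proof.
move=> mA; apply: (@L2_bounded _ 1) => [|x]; first exact: measurable_indic.
by rewrite indicE; case: (_ \in _); rewrite ?normr0 ?normr1.
Qed.

Lemma L2_integrable f : L2 f -> pi.-integrable setT (EFin \o f).
Proof.
move=> f2; apply/Lfun1_integrable; apply: Lfun_subset12 => //.
exact: fin_num_measure.
Qed.

Lemma L2_integrableM f g : L2 f -> L2 g ->
  pi.-integrable setT (EFin \o (fun x => f x * g x)).
Proof. by move=> f2 g2; apply/Lfun1_integrable; exact: Lfun2_mul_Lfun1. Qed.

Lemma innerC f g : inner f g = inner g f.
Proof. by apply: eq_Rintegral => x _; rewrite mulrC. Qed.

Lemma inner_linl f c g h : L2 f -> L2 g -> L2 h ->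
  inner (fun x => f x + c * g x) h = inner f h + c * inner g h.
Proof.
move=> f2 g2 h2; rewrite /Defs.inner -RintegralZl//; last exact: L2_integrableM.
rewrite -RintegralD//; last 2 first.
- exact: L2_integrableM.
- have := integrableZl measurableT c (L2_integrableM g2 h2).
  by apply: eq_integrable.
by apply: eq_Rintegral => x _; rewrite mulrDl mulrA.
Qed.

Lemma inner_linr f c g h : L2 f -> L2 g -> L2 h ->
  inner h (fun x => f x + c * g x) = inner h f + c * inner h g.
Proof. by move=> *; rewrite innerC inner_linl// !(innerC h). Qed.

Lemma Rintegral_lin f c g : L2 f -> L2 g ->
  \int[pi]_x (f x + c * g x) = \int[pi]_x f x + c * \int[pi]_x g x.
Proof.
move=> f2 g2.
rewrite -RintegralZl//; last exact: L2_integrable.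
rewrite -RintegralD//; first exact: L2_integrable.
have := integrableZl measurableT c (L2_integrable g2).
by apply: eq_integrable.
Qed.

Lemma Rintegral_prob_cst c : \int[pi]_x c = c.
Proof.
rewrite Rintegral_cst// [X in fine X](_ : _ = 1%E) ?mulr1//.
exact: probability_setT.
Qed.

Lemma inner_cstl c f : L2 f -> inner (fun=> c) f = c * \int[pi]_x f x.
Proof. by move=> f2; rewrite -RintegralZl//; exact: L2_integrable. Qed.

Lemma inner_ge0 f : 0 <= inner f f.
Proof. by apply: Rintegral_ge0 => x _; rewrite -expr2 sqr_ge0. Qed.

Lemma ae_inner f f' g : L2 f -> L2 f' -> L2 g ->
  f = f' %[ae pi] -> inner f g = inner f' g.
Proof.
move=> f2 f'2 g2 ff'; congr fine; apply: ae_eq_integral => //.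
- exact: measurable_int (L2_integrableM f2 g2).
- exact: measurable_int (L2_integrableM f'2 g2).
- by apply: filterS ff' => x ff' _; rewrite ff'.
Qed.

Lemma ae_Rintegral f g : L2 f -> L2 g -> f = g %[ae pi] ->
  \int[pi]_x f x = \int[pi]_x g x.
Proof.
move=> f2 g2 fg; congr fine; apply: ae_eq_integral => //.
- exact: measurable_int (L2_integrable f2).
- exact: measurable_int (L2_integrable g2).
- by apply: filterS fg => x fg _; rewrite fg.
Qed.

Lemma inner_eq0_ae f : L2 f -> inner f f = 0 -> f = (fun=> 0) %[ae pi].
Proof.
move=> f2 ff0.
have mff := L2_integrableM f2 f2.
have ie0 : (\int[pi]_x `|(f x * f x)%:E| = 0)%E.
  rewrite -[LHS]fineK; last first.
    exact: (integrable_fin_num measurableT (integrable_abse mff)).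
  congr EFin; rewrite -ff0; congr fine; apply: eq_integral => x _ /=.
  by rewrite ger0_norm// -expr2 sqr_ge0.
have := (ae_eq_integral_abs pi measurableT (measurable_int _ mff)).1 ie0.
apply: filterS => x /(_ I) /= [] /eqP.
by rewrite mulf_eq0 orbb => /eqP fx _.
Qed.

Lemma inner_lin2 f c g : L2 f -> L2 g ->
  inner (fun x => f x + c * g x) (fun x => f x + c * g x) =
  inner f f + 2 * c * inner f g + c ^+ 2 * inner g g.
Proof.
move=> f2 g2; rewrite inner_linl//; last exact: L2_lin.
by rewrite !inner_linr// (innerC g f); ring.
Qed.

Lemma cauchy_schwarz f g : L2 f -> L2 g ->
  inner f g ^+ 2 <= inner f f * inner g g.
Proof.
move=> f2 g2; apply: quadratic_ge0_discr => t.
by rewrite -inner_lin2//; exact: inner_ge0.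
Qed.

(** The parallelogram identity, with the nonnegative square of [f - c g] dropped. *)
Lemma inner_lin2_le f c g : L2 f -> L2 g ->
  inner (fun x => f x + c * g x) (fun x => f x + c * g x) <=
  2 * inner f f + 2 * c ^+ 2 * inner g g.
Proof.
move=> f2 g2.
have := inner_ge0 (fun x => f x + (- c) * g x).
by rewrite !inner_lin2//; lra.
Qed.

Lemma norm2E f : L2 f -> norm2 pi f = Num.sqrt (inner f f).
Proof.
move=> f2; rewrite /norm2 unlock /Lnorm.
have -> : (\int[pi]_x `|(EFin \o f) x| `^ 2 = (inner f f)%:E)%E.
  rewrite fineK; last exact: integrable_fin_num (L2_integrableM f2 f2).
  apply: eq_integral => x _ /=.
  by rewrite powR_mulrn// -normrX ger0_norm ?sqr_ge0// expr2.
by rewrite poweR_EFin /= powR12_sqrt// inner_ge0.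
Qed.

(** On [L2] this is the orthogonal projection onto [L20]. *)
Definition centered f : T -> R := fun x => f x - \int[pi]_y f y.

Lemma L2_centered f : L2 f -> L2 (centered f).
Proof.
move=> f2; have := L2_lin (-1) f2 (L2_cst (\int[pi]_y f y)).
by congr (Defs.L2 _ _); apply/funext => x; rewrite mulN1r.
Qed.

Lemma L20_centered f : L2 f -> L20 pi (centered f).
Proof.
move=> f2; split; first exact: L2_centered.
rewrite [LHS](_ : _ = \int[pi]_x (f x + (-1) * \int[pi]_y f y)); last first.
  by apply: eq_Rintegral => x _; rewrite mulN1r.
by rewrite (Rintegral_lin _ f2 (L2_cst _)) Rintegral_prob_cst mulN1r subrr.
Qed.

Lemma centered_id f : L20 pi f -> centered f = f.
Proof. by move=> [_ f0]; apply/funext => x; rewrite /centered f0 subr0. Qed.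

Lemma centered_lin f c g : L2 f -> L2 g ->
  centered (fun x => f x + c * g x) =
  (fun x => centered f x + c * centered g x).
Proof.
by move=> f2 g2; apply/funext => x; rewrite /centered Rintegral_lin//; ring.
Qed.

Lemma inner_centered f : L2 f ->
  inner (centered f) (centered f) = inner f f - (\int[pi]_x f x) ^+ 2.
Proof.
move=> f2; set m := \int[pi]_x f x.
have -> : centered f = (fun x => f x + (-1) * m).
  by apply/funext => x; rewrite mulN1r.
have m2 := L2_cst m.
rewrite (inner_lin2 _ f2 m2) (innerC f) !inner_cstl// Rintegral_prob_cst -/m.
by ring.
Qed.

Lemma inner_centered_le f : L2 f ->
  inner (centered f) (centered f) <= inner f f.
Proof. by move=> f2; rewrite inner_centered// lerBlDr lerDl sqr_ge0. Qed.

Lemma Rintegral_sqr_le f : L2 f -> (\int[pi]_x f x) ^+ 2 <= inner f f.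
Proof. by move=> f2; rewrite -subr_ge0 -inner_centered// inner_ge0. Qed.

Lemma L20_lin f c g : L20 pi f -> L20 pi g -> L20 pi (fun x => f x + c * g x).
Proof.
move=> [f2 f0] [g2 g0]; split; first exact: L2_lin.
by rewrite Rintegral_lin// f0 g0 mulr0 addr0.
Qed.

End SquareIntegrable.

(** * Density of simple functions and extension from indicators to [L2] *)

Section SimpleFunctionDensity.
Context (d : measure_display) (T : measurableType d) (R : realType).
Variable pi : probability T R.
Implicit Types (f g h : T -> R) (c : R).
Local Notation L2 := (L2 pi).
Local Notation inner := (inner pi).

Import HBNNSimple.

Lemma nnsfun_L2_approx f : L2 f -> (forall x, 0 <= f x) ->
  forall e, 0 < e -> exists g : {nnsfun T >-> R}, L2 g /\
    inner (fun x => f x + (-1) * g x) (fun x => f x + (-1) * g x) <= e.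
Proof.
move=> f2 f0 e e0.
have mf : measurable_fun setT (EFin \o f).
  exact/measurable_EFinP/(L2_measurable f2).
have Ef0 x : [set: T] x -> (0 <= (EFin \o f) x)%E by rewrite lee_fin.
pose h n := nnsfun_approx measurableT mf n.
have hf n x : h n x <= f x.
  by have := le_approx n Ef0 (I : setT x); rewrite lee_fin /h nnsfun_approxE.
have hcv x : h n x @[n --> \oo] --> f x.
  have := cvg_nnsfun_approx measurableT mf Ef0 (I : setT x).
  by move/fine_cvg.
have h2 n : L2 (h n).
  apply/L2P; split => //.
  apply: (le_integrable measurableT _ _ ((L2P _ _).1 f2).2).
    by apply/measurable_EFinP; exact: measurable_funX.
  move=> x _ /=; rewrite lee_fin !normrX !ger0_norm//.
  by rewrite lerXn2r ?nnegrE//; exact: f0.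
pose r n x := f x + (-1) * h n x.
have r2 n : L2 (r n) by exact: L2_lin.
(* Since [0 <= h n <= f], the squares of [f - h n] are dominated by the square of [f]. *)
have := @dominated_convergence _ _ _ pi _ measurableT
  (fun n => EFin \o (fun x => r n x * r n x)) (cst 0%E)
  (EFin \o (fun x => f x ^+ 2)).
case.
- by move=> n; exact: measurable_int (L2_integrableM (r2 n) (r2 n)).
- exact: measurable_cst.
- apply: aeW => x _; apply: cvg_EFin; first exact: nearW.
  have rcv : r n x @[n --> \oo] --> (0 : R).
    rewrite (_ : (fun n => r n x) = (fun n => f x - h n x)); last first.
      by apply/funext => n; rewrite /r mulN1r.
    by rewrite -(subrr (f x)); apply: cvgB; [exact: cvg_cst|exact: hcv].
  by rewrite -(mulr0 0); exact: cvgM.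
- exact: ((L2P _ _).1 f2).2.
- apply: aeW => x n _ /=; rewrite lee_fin -expr2 normrX lerXn2r ?nnegrE//.
  rewrite /r mulN1r ger0_norm ?subr_ge0//.
  by rewrite lerBlDr lerDl.
move=> _ _.
rewrite integral0 => /fine_cvg /cvgrPdist_le /(_ e e0) [N _ /(_ N (leqnn N))].
rewrite /= sub0r normrN => hN.
by exists (h N); split => //; exact: le_trans (ler_norm _) hN.
Qed.

(** Indicators span the simple functions, which are dense; closedness is phrased by approximation in
    squared norm, so no topology on [L2] is set up. *)
Lemma L2_ind (K : (T -> R) -> Prop) :
  (forall A, measurable A -> K (\1_A)) ->
  (forall f c g, L2 f -> L2 g -> K f -> K g -> K (fun x => f x + c * g x)) ->
  (forall f, L2 f -> (forall e, 0 < e -> exists g, [/\ L2 g, K g &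
     inner (fun x => f x + (-1) * g x) (fun x => f x + (-1) * g x) <= e]) ->
     K f) ->
  forall f, L2 f -> K f.
Proof.
move=> Kindic Klin Kcl.
have Ksum n (c : nat -> R) (B : nat -> set T) : (forall i, measurable (B i)) ->
    L2 (fun x => \sum_(i < n) c i * \1_(B i) x) /\
    K (fun x => \sum_(i < n) c i * \1_(B i) x).
  move=> mB; elim: n => [|n [IH2 IH]].
    rewrite (_ : (fun _ => _) = \1_(set0 : set T)).
      by split; [exact: L2_indic|exact: Kindic].
    by apply/funext => x; rewrite big_ord0 indic0.
  rewrite (_ : (fun _ => _) =
      (fun x => \sum_(i < n) c i * \1_(B i) x + c n * \1_(B n) x)); last first.
    by apply/funext => x; rewrite big_ord_recr.
  have B2 : L2 (\1_(B n)) by exact: L2_indic.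
  by split; [exact: L2_lin|apply: Klin => //; exact: Kindic].
have Ksimple (g : {nnsfun T >-> R}) : K g.
  pose s := finmap.enum_fset (fset_set (range g)).
  have [_] := Ksum (size s) (fun i => s`_i) (fun i => g @^-1` [set s`_i])
    (fun i => measurable_funPTI g (measurable_set1 _)).
  by congr K; apply/funext => x; rewrite [RHS]fimfunEord.
have Kpos f : L2 f -> (forall x, 0 <= f x) -> K f.
  move=> f2 f0; apply: Kcl => // e e0.
  by have [g [g2 ge]] := nnsfun_L2_approx f2 f0 e0; exists g; split.
move=> f f2.
have bnd (g : T -> R) :
    measurable_fun setT g -> (forall x, `|g x| <= `|f x|) -> L2 g.
  move=> mg gf; apply/L2P; split => //.
  apply: (le_integrable measurableT _ _ ((L2P _ _).1 f2).2).
    by apply/measurable_EFinP; exact: measurable_funX.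
  by move=> x _ /=; rewrite lee_fin !normrX lerXn2r ?nnegrE.
have mf := L2_measurable f2.
have fp2 : L2 (f^\+).
  apply: bnd; first exact: measurable_funrpos.
  by move=> x; rewrite /funrpos; case: (leP 0 (f x)) => h; rewrite ?normr0.
have fn2 : L2 (f^\-).
  apply: bnd; first exact: measurable_funrneg.
  move=> x; rewrite /funrneg; case: (leP 0 (- f x)) => h; rewrite ?normr0 ?normrN//.
have -> : f = fun x => f^\+ x + (-1) * f^\- x.
  apply/funext => x; rewrite /funrpos /funrneg mulN1r.
  case: (leP 0 (f x)); case: (leP 0 (- f x)); lra.
apply: Klin => //; apply: Kpos => // x.
Qed.

(** The kernel of a bounded linear functional is a closed subspace, so [L2_ind] applies to it. *)
Lemma L2_functional_eq0 (D : (T -> R) -> R) (C : R) :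
  (forall A, measurable A -> D (\1_A) = 0) ->
  (forall f c g, L2 f -> L2 g -> D (fun x => f x + c * g x) = D f + c * D g) ->
  (forall f, L2 f -> D f ^+ 2 <= C * inner f f) ->
  forall f, L2 f -> D f = 0.
Proof.
move=> Dindic Dlin DC; apply: L2_ind => //.
  by move=> f c g f2 g2 Df Dg; rewrite Dlin// Df Dg mulr0 addr0.
move=> f f2 happrox; apply/eqP; rewrite -sqrf_eq0 eq_le sqr_ge0 andbT.
apply/ler_addgt0Pl => e e0; rewrite addr0.
(* The denominator absorbs the factor [C], and the added 1 keeps it positive. *)
have [|g [g2 Dg hg]] := happrox (e / (`|C| + 1)).
  by rewrite divr_gt0 ?ltr_wpDl.
have -> : D f = D (fun x => f x + (-1) * g x) by rewrite Dlin// Dg mulr0 addr0.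
apply: le_trans (DC _ (L2_lin _ f2 g2)) _.
have C1 : 0 < `|C| + 1 by rewrite ltr_wpDl.
move: hg; rewrite ler_pdivlMr// mulrC; apply: le_trans.
rewrite ler_wpM2r ?inner_ge0// (le_trans (ler_norm _))//.
by rewrite lerDl.
Qed.

End SimpleFunctionDensity.

(** * The transition kernel as a family of probability measures *)

Section KernelProbability.
Context (d : measure_display) (T : measurableType d) (R : realType).
Variable p : R.-pker T ~> T.

(* p x is only a measure to type inference; this alias makes it a probability. *)
Definition kernel_prob (x : T) : set T -> \bar R := p x.

HB.instance Definition _ (x : T) := Measure.on (kernel_prob x).

HB.instance Definition _ (x : T) :=
  Measure_isProbability.Build d T R (kernel_prob x) (prob_kernel x).

Lemma integral_kernel_prob (x : T) (h : T -> \bar R) :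
  (\int[p x]_y h y = \int[kernel_prob x]_y h y)%E.
Proof. exact: eq_measure_integral. Qed.

Lemma markov_opE (f : T -> R) x : markov_op p f x = \int[kernel_prob x]_y f y.
Proof. by rewrite /markov_op /Rintegral integral_kernel_prob. Qed.

(** As a measurable map into the Giry space, the kernel can be bound to [pi], which supplies the
    iterated-integral formula behind [integral_invariant]. *)
Lemma measurable_fun_kernel_prob :
  measurable_fun setT (kernel_prob : T -> giry T R).
Proof. by apply: measurable_giry_codensity => // B; exact: measurable_kernel. Qed.

End KernelProbability.

(** * The Markov operator as a contraction of [L2] preserving [L20] *)

Section MarkovOperator.
Context (d : measure_display) (T : measurableType d) (R : realType).
Variables (p : R.-pker T ~> T) (pi : probability T R).
Hypothesis inv : Defs.invariant p pi.
Implicit Types (f g h : T -> R) (c : R).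
Local Notation L2 := (L2 pi).
Local Notation L20 := (L20 pi).
Local Notation inner := (inner pi).
Local Notation P := (markov_op p).

(** By invariance the Giry bind of [pi] with the kernel is [pi] itself, so integrating against the
    bind gives both sides. *)
Lemma integral_invariant (h : T -> \bar R) :
  measurable_fun setT h -> (forall x, 0 <= h x)%E ->
  (\int[pi]_x \int[p x]_y h y = \int[pi]_x h x)%E.
Proof.
move=> mh h0.
have := giry_int_bind pi (measurable_fun_kernel_prob p) mh h0.
rewrite /giry_int => hb.
transitivity (\int[pi]_x \int[kernel_prob p x]_y h y)%E.
  by apply: eq_integral => x _; exact: integral_kernel_prob.
rewrite -hb; apply: eq_measure_integral => A mA _.
rewrite /giry_bind /= giry_int_map//; last exact: measurable_giry_ev.
exact: inv.
Qed.

(** By invariance the integral of [f ^ 2] against [p x] is itself [pi]-integrable in [x], hence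
    finite for almost every [x]. *)
Lemma L2_kernel_ae f : L2 f -> {ae pi, forall x, Defs.L2 (kernel_prob p x) f}.
Proof.
move=> /L2P[mf f2].
have mf2 : measurable_fun setT (EFin \o (fun x => f x ^+ 2)).
  exact: measurable_int f2.
have pos x : (0 <= (f x ^+ 2)%R%:E)%E by rewrite lee_fin sqr_ge0.
have mi : measurable_fun setT (fun x => \int[p x]_y (f y ^+ 2)%R%:E)%E.
  by apply: measurable_fun_integral_kernel => //; exact: measurable_kernel.
have : pi.-integrable setT (fun x => \int[p x]_y (f y ^+ 2)%R%:E)%E.
  apply/integrableP; split => //.
  under eq_integral do rewrite gee0_abs ?integral_ge0//.
  rewrite integral_invariant//.
  move/integrableP : f2 => [_]; apply: le_lt_trans.
  by rewrite le_eqVlt; apply/orP; left; apply/eqP; apply: eq_integral => x _;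
    rewrite gee0_abs ?lee_fin ?sqr_ge0.
move=> /(integrable_ae measurableT); apply: filterS => x /(_ I) fin.
apply/L2P; split => //; apply/integrableP; split => //.
rewrite -integral_kernel_prob.
under eq_integral do rewrite gee0_abs ?lee_fin ?sqr_ge0//.
by rewrite ltey_eq fin.
Qed.

Lemma measurable_markov_op f : measurable_fun setT f -> measurable_fun setT (P f).
Proof.
move=> mf; have mEf : measurable_fun setT (EFin \o f) by exact/measurable_EFinP.
have -> : P f = fine \o (fun x => \int[p x]_y (EFin \o f)^\+ y -
                                \int[p x]_y (EFin \o f)^\- y)%E.
  by apply/funext => x; rewrite /markov_op /Rintegral integralE.
apply: measurableT_comp; first exact: fine_measurable.
apply: emeasurable_funB; apply: measurable_fun_integral_kernel => //.
- exact: measurable_kernel.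
- exact: measurable_funepos.
- exact: measurable_kernel.
- exact: measurable_funeneg.
Qed.

(** Jensen's inequality, from the nonnegative variance of [f] under [p x]. It is stated in the
    extended reals because the right-hand side may be infinite for some [x]. *)
Lemma sqr_markov_op_le f x : measurable_fun setT f ->
  ((P f x ^+ 2)%R%:E <= \int[p x]_y (f y ^+ 2)%R%:E)%E.
Proof.
move=> mf; rewrite markov_opE integral_kernel_prob.
set q := kernel_prob p x.
have [fin|] := ltP (\int[q]_y (f y ^+ 2)%R%:E)%E +oo%E; last first.
  by rewrite leye_eq => /eqP ->; rewrite leey.
have f2 : Defs.L2 q f.
  apply/L2P; split => //; apply/integrableP; split.
    by apply/measurable_EFinP; exact: measurable_funX.
  by under eq_integral do rewrite gee0_abs ?lee_fin ?sqr_ge0//.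
rewrite -[leRHS]fineK; last first.
  by rewrite ge0_fin_numE// integral_ge0// => y _; rewrite lee_fin sqr_ge0.
rewrite lee_fin.
have := inner_ge0 q (centered q f); rewrite inner_centered// subr_ge0.
by move/le_trans; apply; rewrite /Defs.inner /Rintegral;
  under eq_integral do rewrite -expr2.
Qed.

Lemma L2_markov_op_le f : L2 f -> L2 (P f) /\ inner (P f) (P f) <= inner f f.
Proof.
move=> /[dup] f2 /L2P[mf if2].
have mPf := measurable_markov_op mf.
have le : (\int[pi]_x (P f x ^+ 2)%R%:E <= \int[pi]_x (f x ^+ 2)%R%:E)%E.
  rewrite -[leRHS]integral_invariant; last 2 first.
  - exact: measurable_int if2.
  - by move=> x; rewrite lee_fin sqr_ge0.
  apply: ge0_le_integral => //.
  - by move=> x _; rewrite lee_fin sqr_ge0.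
  - by apply/measurable_EFinP; exact: measurable_funX.
  - apply: measurable_fun_integral_kernel => //.
    + exact: measurable_kernel.
    + by move=> x; rewrite lee_fin sqr_ge0.
    + exact: measurable_int if2.
  - by move=> x _; exact: sqr_markov_op_le.
have Pf2 : L2 (P f).
  apply/L2P; split => //; apply/integrableP; split.
    by apply/measurable_EFinP; exact: measurable_funX.
  under eq_integral do rewrite gee0_abs ?lee_fin ?sqr_ge0//.
  by rewrite (le_lt_trans le)//; exact: integrable_lty.
split => //; rewrite /Defs.inner -lee_fin !fineK; first last.
- exact: integrable_fin_num (L2_integrableM Pf2 Pf2).
- exact: integrable_fin_num (L2_integrableM f2 f2).
by under eq_integral do rewrite -expr2; under [leRHS]eq_integral do rewrite -expr2.
Qed.

Lemma L2_markov_op f : L2 f -> L2 (P f).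
Proof. by move=> /L2_markov_op_le[]. Qed.

Lemma inner_markov_op_le f : L2 f -> inner (P f) (P f) <= inner f f.
Proof. by move=> /L2_markov_op_le[]. Qed.

(** Additivity of the integral requires integrability under [p x], which is available only for
    almost every [x]. *)
Lemma markov_op_lin f c g : L2 f -> L2 g ->
  P (fun x => f x + c * g x) = (fun x => P f x + c * P g x) %[ae pi].
Proof.
move=> /L2_kernel_ae f2 /L2_kernel_ae g2.
apply: filterS2 f2 g2 => x f2 g2 _.
by rewrite !markov_opE Rintegral_lin.
Qed.

(** By contraction, [P (f - g)] has norm zero as soon as [f - g] does; thus [P] acts on classes of
    functions. *)
Lemma ae_markov_op f g : L2 f -> L2 g -> f = g %[ae pi] -> P f = P g %[ae pi].
Proof.
move=> f2 g2 fg; pose h x := f x + (-1) * g x.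
have h2 : L2 h by exact: L2_lin.
have Ph2 := L2_markov_op h2.
have hh : inner h h = 0.
  rewrite (@ae_inner _ _ _ _ _ (fun=> 0))//; last 2 first.
  - exact: L2_cst.
  - by apply: filterS fg => x /(_ I) fgx _; rewrite /h fgx mulN1r subrr.
  by rewrite inner_cstl// mul0r.
have Ph0 : inner (P h) (P h) = 0.
  by apply/eqP; rewrite eq_le inner_ge0 andbT -hh inner_markov_op_le.
have := inner_eq0_ae Ph2 Ph0.
apply: filterS2 (markov_op_lin (-1) f2 g2) => x /(_ I) e1 /(_ I) e2 _.
by apply/eqP; rewrite -subr_eq0 -mulN1r -e1 -/h e2.
Qed.

Lemma markov_op_cst c : P (fun=> c) = fun=> c.
Proof. by apply/funext => x; rewrite markov_opE Rintegral_prob_cst. Qed.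

Lemma markov_op_indic A x : measurable A -> P (\1_A) x = fine (p x A).
Proof.
by move=> mA; rewrite /markov_op /Rintegral integral_indic// setIT.
Qed.

Lemma Rintegral_markov_op f : L2 f -> \int[pi]_x P f x = \int[pi]_x f x.
Proof.
move=> f2; apply/eqP; rewrite -subr_eq0; apply/eqP.
pose D g := \int[pi]_x P g x - \int[pi]_x g x.
(* The invariance hypothesis is the case of indicators. The constant 4 comes from
   [(x - y)^2 <= 2 (x^2 + y^2)], both squares being at most [inner f f]. *)
apply: (@L2_functional_eq0 _ _ _ pi D 4 _ _ _ f) => // {f f2}.
- move=> A mA; apply/eqP; rewrite subr_eq0; apply/eqP.
  transitivity (fine (\int[pi]_x p x A)%E); last first.
    by rewrite inv// /Rintegral integral_indic// setIT.
  congr fine; apply: eq_integral => x _; rewrite markov_op_indic// fineK//.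
  exact: (fin_num_measure (kernel_prob p x)).
- move=> f c g f2 g2.
  have Pf2 := L2_markov_op f2; have Pg2 := L2_markov_op g2.
  have Pfg2 := L2_markov_op (L2_lin c f2 g2).
  rewrite /D Rintegral_lin//.
  rewrite (ae_Rintegral Pfg2 (L2_lin c Pf2 Pg2) (markov_op_lin c f2 g2)).
  by rewrite Rintegral_lin//; ring.
- move=> f f2; have Pf2 := L2_markov_op f2.
  have -> : 4 * inner f f = 2 * (inner f f + inner f f) by ring.
  apply: sqrrB_le; last exact: Rintegral_sqr_le.
  by rewrite (le_trans (Rintegral_sqr_le Pf2))// inner_markov_op_le.
Qed.

Lemma L20_markov_op f : L20 f -> L20 (P f).
Proof.
by move=> [f2 f0]; split; [exact: L2_markov_op|rewrite Rintegral_markov_op].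
Qed.

Local Notation Pn n := (iter n P).

Lemma L2_iter n f : L2 f -> L2 (Pn n f).
Proof. by move=> f2; elim: n => //= n; exact: L2_markov_op. Qed.

Lemma L20_iter n f : L20 f -> L20 (Pn n f).
Proof. by move=> f2; elim: n => //= n; exact: L20_markov_op. Qed.

Lemma inner_iter_le n f : L2 f -> inner (Pn n f) (Pn n f) <= inner f f.
Proof.
move=> f2; elim: n => //= n; apply: le_trans.
by apply: inner_markov_op_le; exact: L2_iter.
Qed.

Lemma iter_cst n c : Pn n (fun=> c) = fun=> c.
Proof. by elim: n => //= n ->; exact: markov_op_cst. Qed.

Lemma iter_lin n f c g : L2 f -> L2 g ->
  Pn n (fun x => f x + c * g x) = (fun x => Pn n f x + c * Pn n g x) %[ae pi].
Proof.
move=> f2 g2; elim: n => [|n IH]; first exact: aeW.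
have fn2 := L2_iter n f2; have gn2 := L2_iter n g2.
have := ae_markov_op (L2_iter n (L2_lin c f2 g2)) (L2_lin c fn2 gn2) IH.
by move=> h; apply: ae_eq_trans h _; exact: markov_op_lin.
Qed.

Lemma nstep_iter n A x : measurable A -> fine (nstep p n x A) = Pn n (\1_A) x.
Proof.
move=> mA; elim: n x => [|n IH] x.
  by transitivity (fine (dirac x A : \bar R)) => //; rewrite diracE indicE.
rewrite iterS {1}/markov_op; congr fine; apply: eq_integral => y _.
rewrite -IH fineK// ge0_fin_numE//.
apply: (@le_lt_trans _ _ 1%E); last exact: ltry.
rewrite (le_trans _ (sprob_kernel_le1 (nstep p n) y))//.
by rewrite le_measure ?inE.
Qed.

End MarkovOperator.

(** * From isoperimetric constants to the spectral radius *)

Section SpectralRadius.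
Context (d : measure_display) (T : measurableType d) (R : realType).
Variables (p : R.-pker T ~> T) (pi : probability T R).
Hypothesis inv : Defs.invariant p pi.
Hypothesis hex : nontrivial pi !=set0.
Implicit Types (f g h : T -> R) (c : R) (A : set T).
Local Notation L2 := (L2 pi).
Local Notation L20 := (L20 pi).
Local Notation inner := (inner pi).
Local Notation P := (markov_op p).
Local Notation Pn n := (iter n P).

Lemma Rintegral_indic A : measurable A -> \int[pi]_x \1_A x = fine (pi A).
Proof. by move=> mA; rewrite /Rintegral integral_indic// setIT. Qed.

Lemma inner_indic h A : measurable A -> inner h (\1_A) = \int[pi]_(x in A) h x.
Proof.
move=> mA; rewrite [RHS]Rintegral_mkcond; apply: eq_Rintegral => x _.
by rewrite /= patchE indicE; case: ifPn; rewrite ?mulr1 ?mulr0.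
Qed.

Lemma fine_prob_setC A : measurable A -> fine (pi (~` A)) = 1 - fine (pi A).
Proof.
move=> mA; have -> : (pi (~` A) = 1 - pi A)%E by exact: probability_setC.
by rewrite fineB//; exact: fin_num_measure.
Qed.

Lemma inner_centered_indic A : measurable A ->
  inner (centered pi (\1_A)) (centered pi (\1_A)) = fine (pi A) * fine (pi (~` A)).
Proof.
move=> mA; rewrite inner_centered ?Rintegral_indic//; last exact: L2_indic.
have -> : inner (\1_A) (\1_A) = fine (pi A).
  rewrite -Rintegral_indic//; apply: eq_Rintegral => x _.
  by rewrite indicE; case: (_ \in _); rewrite ?mulr1 ?mulr0.
by rewrite fine_prob_setC//; ring.
Qed.

Lemma inner_centered_indic_gt0 A : nontrivial pi A ->
  0 < inner (centered pi (\1_A)) (centered pi (\1_A)).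
Proof.
move=> [mA /andP[A0 A1]].
have fA : pi A \is a fin_num by exact: fin_num_measure.
rewrite inner_centered_indic// fine_prob_setC// mulr_gt0 ?subr_gt0//.
  by rewrite -lte_fin fineK.
by rewrite -lte_fin fineK.
Qed.

Lemma iter_indicE n A : measurable A ->
  Pn n (\1_A) = (fun x => fine (pi A) + 1 * Pn n (centered pi (\1_A)) x) %[ae pi].
Proof.
move=> mA.
have [A2 c2] := (L2_centered (L2_indic pi mA), L2_cst pi (fine (pi A))).
have E : (fun x => fine (pi A) + 1 * centered pi (\1_A) x) = \1_A.
  by apply/funext => x; rewrite /centered Rintegral_indic// mul1r addrC subrK.
by have := iter_lin inv n 1 c2 A2; rewrite iter_cst E.
Qed.

Lemma iter_indicCE n A : measurable A ->
  Pn n (\1_(~` A)) =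
  (fun x => fine (pi (~` A)) + (-1) * Pn n (centered pi (\1_A)) x) %[ae pi].
Proof.
move=> mA.
have [A2 c2] := (L2_centered (L2_indic pi mA), L2_cst pi (fine (pi (~` A)))).
have E : (fun x => fine (pi (~` A)) + (-1) * centered pi (\1_A) x) = \1_(~` A).
  apply/funext => x; rewrite /centered Rintegral_indic// fine_prob_setC//.
  by rewrite !indicE in_setC; case: (_ \in _); rewrite /=; ring.
by have := iter_lin inv n (-1) c2 A2; rewrite iter_cst E.
Qed.

Lemma inner_cst_lin a b f g : L20 f -> L20 g ->
  inner (fun x => a + (-1) * f x) (fun x => b + 1 * g x) = a * b - inner f g.
Proof.
move=> [f2 f0] [g2 g0]; have [a2 b2] := (L2_cst pi a, L2_cst pi b).
rewrite inner_linl//; last exact: L2_lin.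
rewrite !inner_linr// (innerC _ f) !inner_cstl// Rintegral_prob_cst f0 g0; ring.
Qed.

(** Split the indicators of [A] and its complement into their means plus and minus the same centered
    function. [P] fixes constants and preserves [L20], so the cross terms vanish. *)
Lemma inner_iter_indicC n A : measurable A ->
  inner (Pn n (\1_(~` A))) (Pn n (\1_A)) = fine (pi A) * fine (pi (~` A)) -
    inner (Pn n (centered pi (\1_A))) (Pn n (centered pi (\1_A))).
Proof.
move=> mA; have mC := measurableC mA.
have f0 := L20_iter inv n (L20_centered (L2_indic pi mA)).
have [A2 C2] := (L2_iter inv n (L2_indic pi mA), L2_iter inv n (L2_indic pi mC)).
have lA := L2_lin 1 (L2_cst pi (fine (pi A))) f0.1.
have lC := L2_lin (-1) (L2_cst pi (fine (pi (~` A)))) f0.1.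
rewrite (ae_inner C2 lC A2 (iter_indicCE n mA)) innerC.
by rewrite (ae_inner A2 lA lC (iter_indicE n mA)) innerC inner_cst_lin// [X in X - _]mulrC.
Qed.

Lemma inner_iter_indicC1 n A : measurable A ->
  inner (Pn n (\1_(~` A))) (\1_A) = fine (pi A) * fine (pi (~` A)) -
    inner (Pn n (centered pi (\1_A))) (centered pi (\1_A)).
Proof.
move=> mA; have mC := measurableC mA.
have c0 := L20_centered (L2_indic pi mA).
have f0 := L20_iter inv n c0.
have [A2 C2] := (L2_indic pi mA, L2_iter inv n (L2_indic pi mC)).
have lC := L2_lin (-1) (L2_cst pi (fine (pi (~` A)))) f0.1.
rewrite (ae_inner C2 lC A2 (iter_indicCE n mA)).
rewrite [X in inner _ X = _](_ : _ =
    fun x => fine (pi A) + 1 * centered pi (\1_A) x); last first.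
  by apply/funext => x; rewrite /centered Rintegral_indic// mul1r addrC subrK.
by rewrite inner_cst_lin// [X in X - _]mulrC.
Qed.

(** The normalizing factor of [flow] is the squared norm of the centered indicator, so [1 - flow]
    becomes a Rayleigh-type quotient. *)
Lemma flowE h A (q : R) : nontrivial pi A ->
  inner h (\1_A) = fine (pi A) * fine (pi (~` A)) - q ->
  flow pi h A = 1 - q / inner (centered pi (\1_A)) (centered pi (\1_A)).
Proof.
move=> ntA; have := inner_centered_indic_gt0 ntA; case: ntA => mA _.
rewrite inner_centered_indic// => pos.
by rewrite inner_indic// /flow => ->; rewrite mulrBr mulVf ?lt0r_neq0// [_^-1 * q]mulrC.
Qed.

(** Abstracting over [q] treats the normal and the positive case together. Of quadratic forms only a
    weakened parallelogram inequality is kept. The last conclusion bounds [1 - k n] by any constant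
    valid on all of [L20], because it is a supremum over centered indicators. *)
Lemma isoperimetric_root_cvg (q : nat -> (T -> R) -> R) (phi : nat -> set T -> R) :
  (forall f, L20 f -> q 0%N f = inner f f) ->
  (forall n f, L20 f -> 0 <= q n f <= inner f f) ->
  (forall n f, L20 f -> q n.+1 f ^+ 2 <= q n f * q n.+2 f) ->
  (forall n f c g, L20 f -> L20 g ->
     q n (fun x => f x + c * g x) <= 2 * q n f + 2 * c ^+ 2 * q n g) ->
  (forall n A, nontrivial pi A -> phi n A =
     1 - q n (centered pi (\1_A)) / inner (centered pi (\1_A)) (centered pi (\1_A))) ->
  exists s : R, let k n := inf [set phi n A | A in nontrivial pi] in
  [/\ 0 <= s, (1 - k n) `^ n%:R^-1 @[n --> \oo] --> s,
    (forall n f, L20 f -> q n f <= s ^+ n * inner f f) &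
    (forall n, 0 <= 1 - k n /\
       forall C, (forall f, L20 f -> q n f <= C * inner f f) -> 1 - k n <= C)].
Proof.
move=> q0 q01 qlc qlin phiE.
pose cA A := centered pi (\1_A); pose nA A := inner (cA A) (cA A).
pose a A n := q n (cA A) / nA A.
have c0 A : measurable A -> L20 (cA A) by move=> mA; exact: L20_centered (L2_indic pi mA).
have nApos A : nontrivial pi A -> 0 < nA A by exact: inner_centered_indic_gt0.
pose k n := inf [set phi n A | A in nontrivial pi].
have a01 A n : nontrivial pi A -> 0 <= a A n <= 1.
  move=> ntA; have /andP[h0 h1] := q01 n _ (c0 A ntA.1).
  by rewrite /a divr_ge0 ?(ltW (nApos _ _))//= ler_pdivrMr ?mul1r// nApos.
have ne n : [set phi n A | A in nontrivial pi] !=set0.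
  by have [A ntA] := hex; exists (phi n A); exists A.
have lb n : has_lbound [set phi n A | A in nontrivial pi].
  exists 0 => _ [A ntA <-]; rewrite phiE// -/(cA A) -/(nA A) -/(a A n) subr_ge0.
  by case/andP: (a01 A n ntA).
have ak A n : nontrivial pi A -> a A n <= 1 - k n.
  move=> ntA; rewrite lerBrDr addrC -lerBrDr.
  have -> : 1 - a A n = phi n A by rewrite phiE.
  by apply: ge_inf => //; exists A.
have kmin n C : (forall A, nontrivial pi A -> a A n <= C) -> 1 - k n <= C.
  move=> aC; rewrite lerBlDr addrC -lerBlDr; apply: lb_le_inf => // _ [A ntA <-].
  by rewrite phiE// lerB// aC.
have alc A n : nontrivial pi A -> a A n.+1 ^+ 2 <= a A n * a A n.+2.
  move=> ntA; rewrite /a expr_div_n mulf_div -expr2 ler_wpM2r ?invr_ge0 ?sqr_ge0//.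
  exact: qlc (c0 A ntA.1).
have a1 A : nontrivial pi A -> a A 0%N = 1.
  by move=> ntA; rewrite /a q0 ?divff ?gt_eqF ?nApos//; exact: c0 ntA.1.
have [s [s0 s1 cv as_]] := logconvex_sup_root_cvg hex a1 a01 alc ak kmin.
exists s; split => //; last first.
  move=> n; split.
    have [A ntA] := hex; apply: le_trans (ak A n ntA).
    by case/andP: (a01 A n ntA).
  move=> C qC; apply: kmin => A ntA; rewrite /a ler_pdivrMr ?nApos//.
  exact: qC (c0 A ntA.1).
have qge n f : L20 f -> 0 <= q n f by move=> /(q01 n) /andP[].
have qle n f : L20 f -> q n f <= inner f f by move=> /(q01 n) /andP[].
(* Any constant C may be replaced by inner f f. *)
have drop f C : L20 f -> (forall n, q n f <= C * s ^+ n) ->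
    forall n, q n f <= s ^+ n * inner f f.
  move=> f0 qC n; rewrite -q0// mulrC.
  apply: (logconvex_geometric_bound (u := fun n => q n f) s0 _ _ qC) => m.
    exact: qge.
  exact: qlc.
(* Centering lets the induction run over all of [L2]; on [L20] it is the identity. *)
pose K f := forall n, q n (centered pi f) <= s ^+ n * inner (centered pi f) (centered pi f).
suff KT : forall f, L2 f -> K f.
  by move=> n f f0; have := KT f f0.1 n; rewrite centered_id.
apply: L2_ind.
- move=> A mA n; have [ntA|triv] := pselect (nontrivial pi A).
    by rewrite -ler_pdivrMr; [exact: as_|exact: nApos].
  (* For a set of measure 0 or 1 the centered indicator has norm zero, and both sides vanish. *)
  have z : nA A = 0.
    rewrite /nA inner_centered_indic// fine_prob_setC//.
    have fA : pi A \is a fin_num by exact: fin_num_measure.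
    have : fine (pi A) = 0 \/ fine (pi A) = 1.
      have A0 : (0 <= pi A)%E by [].
      have A1 : (pi A <= 1)%E by exact: probability_le1.
      move: A0; rewrite le_eqVlt => /predU1P[<-|A0]; first by left.
      move: A1; rewrite le_eqVlt => /predU1P[->|A1]; first by right.
      by exfalso; apply: triv; split => //; apply/andP.
    by case=> ->; rewrite ?mul0r// subrr mulr0.
  rewrite -/(cA A) -/(nA A) z mulr0 -z; apply: qle; exact: c0.
- move=> f c g f2 g2 Kf Kg n.
  have [f0 g0] := (L20_centered f2, L20_centered g2).
  rewrite centered_lin//.
  set nf := inner (centered pi f) (centered pi f).
  set ng := inner (centered pi g) (centered pi g).
  apply: (drop _ (2 * nf + 2 * c ^+ 2 * ng)); first exact: L20_lin.
  move=> m; apply: le_trans (qlin m _ c _ f0 g0) _.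
  have hf : q m (centered pi f) <= s ^+ m * nf := Kf m.
  have hg : c ^+ 2 * q m (centered pi g) <= c ^+ 2 * (s ^+ m * ng).
    by rewrite ler_wpM2l ?sqr_ge0//; exact: Kg.
  rewrite [leRHS](_ : _ = 2 * (s ^+ m * nf) + 2 * (c ^+ 2 * (s ^+ m * ng))).
    by rewrite -mulrA lerD// ler_wpM2l.
  by ring.
- move=> f f2 approx.
  have f0 := L20_centered f2.
  set nf := inner (centered pi f) (centered pi f).
  (* With [f = g + r], the bound on [q n] and then the bound on the norm of [g] each cost a factor
     2, giving 4. The errors are [2 * (e / 6)] and [2 * (2 * (e / 6))], which add up to [e]. *)
  apply: (drop _ (4 * nf)) => // n.
  apply/ler_addgt0Pr => e e0.
  have [|g [g2 Kg hg]] := approx (e / 6); first by rewrite divr_gt0.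
  have g0 := L20_centered g2.
  have r2 := L2_lin (-1) f2 g2.
  have r0 := L20_centered r2.
  set r := fun x => f x + (-1) * g x in hg r2 r0.
  have nr : inner (centered pi r) (centered pi r) <= e / 6.
    exact: le_trans (inner_centered_le r2) hg.
  have fE : centered pi f = fun x => centered pi g x + 1 * centered pi r x.
    by rewrite /r centered_lin//; apply/funext => x; ring.
  have gE : centered pi g = fun x => centered pi f x + (-1) * centered pi r x.
    by rewrite /r centered_lin//; apply/funext => x; ring.
  have qf : q n (centered pi f) <= 2 * q n (centered pi g) + 2 * (e / 6).
    rewrite {1}fE; apply: le_trans (qlin n _ 1 _ g0 r0) _.
    rewrite expr1n mulr1 lerD2l ler_wpM2l//.
    by rewrite (le_trans _ nr)// qle.
  have ng : inner (centered pi g) (centered pi g) <= 2 * nf + 2 * (e / 6).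
    rewrite {1 2}gE; apply: le_trans (inner_lin2_le _ f0.1 r0.1) _.
    by rewrite sqrrN expr1n mulr1 lerD2l ler_wpM2l.
  have sn : s ^+ n <= 1 by rewrite exprn_ile1.
  have sn0 : 0 <= s ^+ n by rewrite exprn_ge0.
  have := Kg n; set ig := inner _ _ in ng * => hKg.
  have ng' : s ^+ n * ig <= s ^+ n * (2 * nf) + 2 * (e / 6).
    apply: (le_trans (ler_wpM2l sn0 ng)); rewrite mulrDr lerD2l.
    by rewrite ler_piMl// mulr_ge0// divr_ge0// ltW.
  lra.
Qed.

Lemma iter_scale_sqr n t f : L2 f ->
  inner (Pn n (fun x => t * f x)) (Pn n (fun x => t * f x)) =
  t ^+ 2 * inner (Pn n f) (Pn n f).
Proof.
move=> f2; have z2 := L2_cst pi 0.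
have := iter_lin inv n t z2 f2; rewrite iter_cst.
rewrite (_ : (fun x => 0 + t * f x) = (fun x => t * f x)); last first.
  by apply/funext => x; rewrite add0r.
have tf2 : L2 (fun x => t * f x).
  have := L2_lin t z2 f2; congr (Defs.L2 _ _).
  by apply/funext => x; rewrite add0r.
have fn2 := L2_iter inv n f2; have tfn2 := L2_iter inv n tf2.
have l2 := L2_lin t z2 fn2.
move=> h; rewrite (ae_inner tfn2 l2 tfn2 h) innerC (ae_inner tfn2 l2 l2 h).
by rewrite inner_lin2// !inner_cstl// !mul0r mulr0 !add0r.
Qed.

(** The suprema [S n] defining the spectral radius are squeezed between [w n] and [r] for positive
    [n]. The lower bound uses the last hypothesis with [c = S n], whose n-th power bounds [P^n] on
    [L20]. *)
Lemma cvg_spectral_radius (w : nat -> R) (r : R) : 0 <= r ->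
  w n @[n --> \oo] --> r ->
  (forall n f, L20 f -> inner (Pn n f) (Pn n f) <= (r ^+ n) ^+ 2 * inner f f) ->
  (forall n c, 0 <= c ->
    (forall f, L20 f ->
       inner (Pn n.+1 f) (Pn n.+1 f) <= (c ^+ n.+1) ^+ 2 * inner f f) ->
    w n.+1 <= c) ->
  w n @[n --> \oo] --> spectral_radius p pi.
Proof.
move=> r0 wr Pr wmin.
pose U := [set f | L20 f /\ norm2 pi f = 1].
pose S n := sup [set norm2 pi (Pn n f) `^ n%:R^-1 | f in U].
have normalize f : L20 f -> 0 < inner f f -> U (fun x => (Num.sqrt (inner f f))^-1 * f x).
  move=> [f2 f0] fp; set t := _^-1.
  have tf2 : L2 (fun x => t * f x).
    have := L2_lin t (L2_cst pi 0) f2; congr (Defs.L2 _ _).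
    by apply/funext => x; rewrite add0r.
  split; first by split => //; rewrite RintegralZl ?f0 ?mulr0//; exact: L2_integrable.
  rewrite norm2E//; have := iter_scale_sqr 0 t f2; rewrite /= => ->.
  by rewrite /t exprVn sqr_sqrtr ?(ltW fp)// mulVf ?gt_eqF// sqrtr1.
have ne n : [set norm2 pi (Pn n f) `^ n%:R^-1 | f in U] !=set0.
  have [A ntA] := hex.
  have := normalize _ (L20_centered (L2_indic pi ntA.1)) (inner_centered_indic_gt0 ntA).
  by move=> Uu; eexists; eexists; [exact: Uu|].
have inU f : U f -> inner f f = 1.
  move=> [[f2 _]]; rewrite norm2E// => h.
  by rewrite -(sqr_sqrtr (inner_ge0 _ _)) h expr1n.
have Ur n f : U f -> norm2 pi (Pn n.+1 f) `^ n.+1%:R^-1 <= r.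
  move=> Uf; have f0 := Uf.1.
  have fn2 := L2_iter inv n.+1 f0.1.
  rewrite norm2E//; apply: ler_rootn => //.
  rewrite -(ger0_norm (exprn_ge0 n.+1 r0)) -sqrtr_sqr ler_wsqrtr//.
  by have := Pr n.+1 f f0; rewrite (inU f Uf) mulr1.
have Sr n : S n.+1 <= r.
  by apply: ge_sup => // _ [f Uf <-]; exact: Ur.
have SU n f : U f -> norm2 pi (Pn n.+1 f) `^ n.+1%:R^-1 <= S n.+1.
  move=> Uf; apply: ub_le_sup; last by exists f.
  by exists r => _ [g Ug <-]; exact: Ur.
have S0 n : 0 <= S n.+1.
  have [_ [f Uf _]] := ne n.+1.
  exact: le_trans (powR_ge0 _ _) (SU n f Uf).
have wS n : w n.+1 <= S n.+1.
  apply: wmin => // f f0; have fn2 := L2_iter inv n.+1 f0.1.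
  (* A function of norm zero cannot be normalized; contraction settles that case. *)
  have := inner_ge0 pi f; rewrite le_eqVlt => /predU1P[z|fp].
    by rewrite -z mulr0 z; exact: inner_iter_le f0.1.
  have Uu := normalize f f0 fp.
  have := SU n _ Uu; set u := (fun x => _) in Uu *.
  have un2 : L2 (Pn n.+1 u) := L2_iter inv n.+1 Uu.1.1.
  move=> h.
  have : norm2 pi (Pn n.+1 u) <= S n.+1 ^+ n.+1.
    rewrite -(rootnK n (x := norm2 pi (Pn n.+1 u))).
      by rewrite lerXn2r ?nnegrE ?powR_ge0.
    by rewrite norm2E// sqrtr_ge0.
  rewrite norm2E//.
  move=> /(lerXn2r 2); rewrite ?nnegrE sqrtr_ge0 exprn_ge0// => /(_ isT isT).
  rewrite sqr_sqrtr ?inner_ge0// iter_scale_sqr//; last exact: f0.1.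
  by rewrite exprVn sqr_sqrtr ?(ltW fp)// ler_pdivrMl// mulrC.
suff Scv : S n @[n --> \oo] --> r by rewrite /spectral_radius (cvg_lim _ Scv).
rewrite -cvg_shiftS; apply: (@squeeze_cvgr _ _ _ _ (fun n => w n.+1) (fun=> r)).
- by apply: nearW => n; rewrite wS Sr.
- by rewrite (cvg_shiftS w).
- exact: cvg_cst.
Qed.

End SpectralRadius.

(** * Normal, reversible and positive chains *)

Section Adjoint.
Context (d : measure_display) (T : measurableType d) (R : realType).
Variables (p : R.-pker T ~> T) (pi : probability T R).
Hypothesis inv : Defs.invariant p pi.
Hypothesis hex : nontrivial pi !=set0.
Implicit Types (f g h : T -> R) (c : R) (A : set T).
Local Notation L2 := (L2 pi).
Local Notation L20 := (L20 pi).
Local Notation inner := (inner pi).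
Local Notation P := (markov_op p).
Local Notation Pn n := (iter n P).

Lemma inner_iter_lin2_le n f c g : L2 f -> L2 g ->
  inner (Pn n (fun x => f x + c * g x)) (Pn n (fun x => f x + c * g x)) <=
  2 * inner (Pn n f) (Pn n f) + 2 * c ^+ 2 * inner (Pn n g) (Pn n g).
Proof.
move=> f2 g2; have fn2 := L2_iter inv n f2; have gn2 := L2_iter inv n g2.
have l2 := L2_lin c fn2 gn2; have ln2 := L2_iter inv n (L2_lin c f2 g2).
have h := iter_lin inv n c f2 g2.
rewrite (ae_inner ln2 l2 ln2 h) innerC (ae_inner ln2 l2 l2 h).
exact: inner_lin2_le.
Qed.

(** * Normal operators *)

Section GivenAdjoint.
Variable Pstar : (T -> R) -> T -> R.
Hypothesis adj : is_adjoint pi P Pstar.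

Lemma inner_iter_adjoint n h g : L2 h -> L2 g ->
  L2 (iter n Pstar h) /\ inner (iter n Pstar h) g = inner h (Pn n g).
Proof.
move=> h2; elim: n g => [|n IH] g g2 //=.
have [hn2 _] := IH g g2; have [Phn2 hadj] := adj hn2; split => //.
rewrite innerC -hadj// innerC (IH _ (L2_markov_op inv g2)).2.
by rewrite -iterSr.
Qed.

Hypothesis nrm : normal_with pi P Pstar.

(** Both sides are quadratic forms at [f], of [P Pstar] and of [Pstar P] respectively. *)
Lemma inner_adjoint_normal f : L20 f -> inner (Pstar f) (Pstar f) = inner (P f) (P f).
Proof.
move=> f0; have [Psf2 adjf] := adj f0.1.
have Pf2 := L2_markov_op inv f0.1.
have [PsPf2 adjPf] := adj Pf2.
have PPsf2 := L2_markov_op inv Psf2.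
rewrite -adjf// (ae_inner PPsf2 PsPf2 f0.1 (nrm f0)).
by rewrite innerC -adjPf//; exact: f0.1.
Qed.

(** With [g = P^n f], the squared norm of [P g] is the inner product of [g] and [Pstar (P g)].
    Cauchy-Schwarz applies, and normality replaces the norm of [Pstar (P g)] by that of
    [P (P g)]. *)
Lemma normal_iter_logconvex n f : L20 f ->
  inner (Pn n.+1 f) (Pn n.+1 f) ^+ 2 <=
  inner (Pn n f) (Pn n f) * inner (Pn n.+2 f) (Pn n.+2 f).
Proof.
move=> f0; have g0 := L20_iter inv n f0; have Pg0 := L20_markov_op inv g0.
have [PsPg2 h] := adj Pg0.1.
rewrite [Pn n.+1 f]/= h; last exact: g0.1.
by rewrite -inner_adjoint_normal//; apply: cauchy_schwarz => //; exact: g0.1.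
Qed.

Lemma normal_spectral_radius :
  (Num.sqrt (1 - k_adj p pi Pstar n)) `^ n%:R^-1 @[n --> \oo]
    --> spectral_radius p pi.
Proof.
have [||||n A ntA|s [s0 cv bnd kC]] := @isoperimetric_root_cvg _ _ _ pi hex
    (fun n f => inner (Pn n f) (Pn n f))
    (fun n A => flow pi (iter n Pstar (Pn n (\1_(~` A)))) A).
- by [].
- by move=> n f [f2 _]; rewrite inner_ge0 inner_iter_le.
- exact: normal_iter_logconvex.
- by move=> n f c g [f2 _] [g2 _]; exact: inner_iter_lin2_le.
- apply: flowE => //; have [mA _] := ntA.
  have Cn2 := L2_iter inv n (L2_indic pi (measurableC mA)).
  rewrite (inner_iter_adjoint n Cn2 (L2_indic pi mA)).2.
  exact: inner_iter_indicC.
have k0 n : 0 <= 1 - k_adj p pi Pstar n by case: (kC n).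
(* Here [s] is the rate of the squared norms, hence the square root. *)
apply: (@cvg_spectral_radius _ _ _ _ _ inv hex _ (Num.sqrt s)) => //.
- rewrite (_ : (fun n => _) =
      (fun n => Num.sqrt ((1 - k_adj p pi Pstar n) `^ n%:R^-1))).
    by apply: continuous_cvg => //; exact: sqrt_continuous.
  by apply/funext => n; rewrite sqrt_rootn.
- by move=> n f f0; rewrite exprAC sqr_sqrtr//; exact: bnd.
- move=> n c c0 h; apply: ler_rootn => //.
  rewrite -(ger0_norm (exprn_ge0 n.+1 c0)) -sqrtr_sqr ler_wsqrtr//.
  exact: (kC n.+1).2.
Qed.

End GivenAdjoint.

(** * Reversible chains: selfadjointness *)

Section Reversible.
Hypothesis rev : reversible p pi.

(** Reversibility evaluated on the rectangle with sides [B] and [A]. *)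
Lemma reversible_indic A B : measurable A -> measurable B ->
  inner (P (\1_A)) (\1_B) = inner (\1_A) (P (\1_B)).
Proof.
move=> mA mB; have := rev (measurableX mB mA) => revAB.
have fin x (C : set T) : (p x C) \is a fin_num -> measurable C ->
  ((P (\1_C) x)%:E = p x C)%E.
  by move=> fC mC; rewrite markov_op_indic// fineK.
have pfin x (C : set T) : measurable C -> p x C \is a fin_num.
  exact: (fin_num_measure (kernel_prob p x)).
rewrite /Defs.inner /Rintegral; congr fine.
transitivity (\int[pi]_x p x (xsection (B `*` A) x))%E.
  apply: eq_integral => x _; rewrite indicE.
  have [xB|xB] := boolP (x \in B).
    by rewrite in_xsectionX// mulr1 fin// pfin.
  by rewrite notin_xsectionX// measure0 mulr0.
rewrite revAB; apply: eq_integral => x _; rewrite indicE.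
have [xA|xA] := boolP (x \in A).
  by rewrite in_ysectionX// mul1r fin// pfin.
by rewrite notin_ysectionX// measure0 mul0r.
Qed.

Lemma inner_lin_markov_op f c g h : L2 f -> L2 g -> L2 h ->
  inner (P (fun x => f x + c * g x)) h = inner (P f) h + c * inner (P g) h.
Proof.
move=> f2 g2 h2; have Pf2 := L2_markov_op inv f2; have Pg2 := L2_markov_op inv g2.
have Pl2 := L2_markov_op inv (L2_lin c f2 g2).
by rewrite (ae_inner Pl2 (L2_lin c Pf2 Pg2) h2 (markov_op_lin inv c f2 g2)) inner_linl.
Qed.

(** This is the boundedness that [L2_functional_eq0] asks for; each of the two terms has square at
    most [inner f f * inner g g]. *)
Lemma adjoint_defect_le f g : L2 f -> L2 g ->
  (inner (P f) g - inner f (P g)) ^+ 2 <= 4 * inner g g * inner f f.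
Proof.
move=> f2 g2; have Pf2 := L2_markov_op inv f2; have Pg2 := L2_markov_op inv g2.
rewrite (_ : 4 * _ * _ = 2 * (inner f f * inner g g + inner f f * inner g g)).
  apply: sqrrB_le; apply: le_trans (cauchy_schwarz _ _) _ => //.
    by rewrite ler_wpM2r ?inner_ge0 ?inner_markov_op_le.
  by rewrite ler_wpM2l ?inner_ge0 ?inner_markov_op_le.
by ring.
Qed.

Lemma reversible_selfadjoint f g : L2 f -> L2 g -> inner (P f) g = inner f (P g).
Proof.
move=> f2 g2; apply/eqP; rewrite -subr_eq0; apply/eqP.
(* The defect D vanishes on indicators; extend in one variable at a time. *)
pose D f g := inner (P f) g - inner f (P g).
have Dlin f1 f3 c h : L2 f1 -> L2 f3 -> L2 h ->
    D (fun x => f1 x + c * f3 x) h = D f1 h + c * D f3 h.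
  move=> ? ? h2; have Ph2 := L2_markov_op inv h2.
  by rewrite /D inner_lin_markov_op// inner_linl//; ring.
have Dsym h1 h2 : D h1 h2 = - D h2 h1.
  by rewrite /D opprB (innerC _ h1) (innerC _ (P h1)).
have DA h A : measurable A -> L2 h -> D h (\1_A) = 0.
  move=> mA; have A2 := L2_indic pi mA.
  apply: (@L2_functional_eq0 _ _ _ pi (fun h => D h (\1_A))
    (4 * inner (\1_A) (\1_A))).
  - by move=> B mB; rewrite /D reversible_indic// subrr.
  - by move=> *; exact: Dlin.
  - by move=> *; exact: adjoint_defect_le.
apply: (@L2_functional_eq0 _ _ _ pi (fun h => D h g) (4 * inner g g)) => //.
- by move=> A mA; rewrite Dsym DA// oppr0.
- by move=> *; exact: Dlin.
- by move=> *; exact: adjoint_defect_le.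
Qed.

Lemma reversible_adjoint : is_adjoint pi P P.
Proof.
move=> g g2; split; first exact: L2_markov_op.
by move=> f f2; exact: reversible_selfadjoint.
Qed.

Lemma k_step_double n : k_step p pi (2 * n) = k_adj p pi P n.
Proof.
rewrite /k_step /k_adj; congr inf; apply: eq_imagel => A [mA _].
congr flow; apply/funext => x.
by rewrite nstep_iter//; [rewrite mul2n -addnn iterD|exact: measurableC].
Qed.

Lemma inner_iterC n f g : L2 f -> L2 g -> inner (Pn n f) g = inner (Pn n g) f.
Proof.
by move=> f2 g2; rewrite (inner_iter_adjoint reversible_adjoint n f2 g2).2 innerC.
Qed.

(** Moving one [P] across lowers the exponent by two at the price of replacing [f] by [P f]; the
    inductions for positive chains descend this way. *)
Lemma inner_iterSS n f : L2 f -> inner (Pn n.+2 f) f = inner (Pn n (P f)) (P f).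
Proof.
move=> f2; have g2 := L2_iter inv n (L2_markov_op inv f2).
by rewrite iterSr iterS reversible_selfadjoint.
Qed.

Lemma inner_iter_lin2 n f c g : L2 f -> L2 g ->
  inner (Pn n (fun x => f x + c * g x)) (fun x => f x + c * g x) =
  inner (Pn n f) f + 2 * c * inner (Pn n f) g + c ^+ 2 * inner (Pn n g) g.
Proof.
move=> f2 g2; have fn2 := L2_iter inv n f2; have gn2 := L2_iter inv n g2.
have l2 := L2_lin c f2 g2.
rewrite (ae_inner (L2_iter inv n l2) (L2_lin c fn2 gn2) l2 (iter_lin inv n c f2 g2)).
by rewrite inner_linl// !inner_linr// (inner_iterC n g2 f2); ring.
Qed.

(** Turns norm bounds on [P^n] into bounds on its quadratic form, the quantity that governs
    [k_step]. *)
Lemma inner_iter_cauchy_schwarz n f C : L2 f -> 0 <= C ->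
  inner (Pn n f) (Pn n f) <= C ^+ 2 * inner f f -> inner (Pn n f) f <= C * inner f f.
Proof.
move=> f2 C0 h.
have [neg|/ltW pos] := leP (inner (Pn n f) f) 0.
  by rewrite (le_trans neg)// mulr_ge0// inner_ge0.
rewrite -(@ler_pXn2r _ 2) ?nnegrE ?mulr_ge0 ?inner_ge0//.
apply: le_trans (cauchy_schwarz (L2_iter inv n f2) f2) _.
by rewrite exprMn [inner f f ^+ 2]expr2 mulrA ler_wpM2r ?inner_ge0.
Qed.

(** * Positive reversible chains *)

Section Positive.
Hypothesis pos : positive_op pi P.

(** Descending by two, even exponents end at a squared norm and odd ones at the positivity of
    [P]. *)
Lemma positive_iter_ge0 n f : L20 f -> 0 <= inner (Pn n f) f.
Proof.
have [m] := ubnP n; elim: m n f => // m IH [|[|n]] f /ltnSE nm f0.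
- exact: inner_ge0.
- exact: pos.
- rewrite inner_iterSS; last exact: f0.1.
  by apply: IH; [exact: ltnW|exact: L20_markov_op].
Qed.

(** Descending by two again, the case 0 is Cauchy-Schwarz for [inner], and the case 1 is
    Cauchy-Schwarz for the semidefinite form of [P] at [f] and [P f], read off from a
    discriminant. *)
Lemma positive_iter_logconvex n f : L20 f ->
  inner (Pn n.+1 f) f ^+ 2 <= inner (Pn n f) f * inner (Pn n.+2 f) f.
Proof.
have [m] := ubnP n; elim: m n f => // m IH [|[|n]] f /ltnSE nm f0.
- have f2 := f0.1; rewrite (inner_iterSS 0 f2).
  by rewrite mulrC; apply: cauchy_schwarz => //; exact: L2_markov_op.
- have f2 := f0.1; have Pf0 := L20_markov_op inv f0.
  rewrite (inner_iterSS 0 f2) (inner_iterSS 1 f2).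
  apply: quadratic_ge0_discr => t.
  rewrite -(inner_iter_lin2 1 t f2 Pf0.1).
  by apply: pos; exact: L20_lin.
- have f2 := f0.1.
  rewrite [X in X ^+ 2 <= _](inner_iterSS n.+1 f2).
  rewrite [X in _ <= X * _](inner_iterSS n f2).
  rewrite [X in _ <= _ * X](inner_iterSS n.+2 f2).
  by apply: IH; [exact: ltnW|exact: L20_markov_op].
Qed.

Lemma positive_spectral_radius :
  (1 - k_step p pi n) `^ n%:R^-1 @[n --> \oo] --> spectral_radius p pi.
Proof.
have [||||n A ntA|s [s0 cv bnd kC]] := @isoperimetric_root_cvg _ _ _ pi hex
    (fun n f => inner (Pn n f) f)
    (fun n A => flow pi (fun x => fine (nstep p n x (~` A))) A).
- by [].
- move=> n f f0; rewrite positive_iter_ge0//= -[leRHS]mul1r.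
  apply: inner_iter_cauchy_schwarz => //; first exact: f0.1.
  by rewrite expr1n mul1r inner_iter_le//; exact: f0.1.
- exact: positive_iter_logconvex.
- move=> n f c g f0 g0.
  (* Nonnegativity of the form at [f - c g] is what the parallelogram identity discards. *)
  have := positive_iter_ge0 n (L20_lin (- c) f0 g0).
  by rewrite !inner_iter_lin2 ?sqrrN; [lra|exact: f0.1|exact: g0.1|exact: f0.1|exact: g0.1].
- apply: flowE => //; have [mA _] := ntA.
  rewrite (_ : (fun x => _) = Pn n (\1_(~` A))); first exact: inner_iter_indicC1.
  by apply/funext => x; rewrite nstep_iter//; exact: measurableC.
apply: (@cvg_spectral_radius _ _ _ _ _ inv hex _ s) => //.
- move=> n f f0; have f2 := f0.1.
  (* By selfadjointness the squared norm is the form at exponent [2n], of rate [s ^ (2n)]; so the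
     radius is [s] itself, without a square root. *)
  have -> : inner (Pn n f) (Pn n f) = inner (Pn (n + n) f) f.
    by rewrite iterD (inner_iter_adjoint reversible_adjoint n (L2_iter inv n f2) f2).2.
  by rewrite -exprM muln2 -addnn; exact: bnd.
- move=> n c c0 h; apply: ler_rootn => //; first by case: (kC n.+1).
  apply: (kC n.+1).2 => f f0; apply: inner_iter_cauchy_schwarz.
  + exact: f0.1.
  + exact: exprn_ge0.
  + exact: h.
Qed.

End Positive.
End Reversible.
End Adjoint.

Theorem corollary4 (d : measure_display) (T : measurableType d) (R : realType)
    (p : R.-pker T ~> T) (pi : probability T R)
    (hgen : countably_generated T)
    (hirr : irreducible p pi)
    (hrec : positive_recurrent p pi)
    (hex : nontrivial pi !=set0) :
  (forall Pstar : (T -> R) -> T -> R,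
     is_adjoint pi (markov_op p) Pstar ->
     normal_with pi (markov_op p) Pstar ->
     (Num.sqrt (1 - k_adj p pi Pstar n)) `^ n%:R^-1 @[n --> \oo]
       --> spectral_radius p pi)
  /\ (reversible p pi ->
     (Num.sqrt (1 - k_step p pi (2 * n))) `^ n%:R^-1 @[n --> \oo]
       --> spectral_radius p pi)
  /\ (reversible p pi -> positive_op pi (markov_op p) ->
     (1 - k_step p pi n) `^ n%:R^-1 @[n --> \oo]
       --> spectral_radius p pi).
Proof.
have [_ [inv _]] := hrec.
split; first by move=> Pstar adj nrm; exact: normal_spectral_radius.
split => rev; last by move=> pos; exact: positive_spectral_radius.
(* A reversible chain is normal with [P] as its own adjoint, which reduces the claim to the normal
   case. *)
under eq_fun do rewrite k_step_double//.
apply: normal_spectral_radius => //; first exact: reversible_adjoint.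
by move=> f f0; exact: ae_eq_refl.
Qed.
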